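(* Let $A$ be a unital $C^*$-algebra and $T$ an observable affiliated to $A$. Let $\mathcal F$ be a set of representations of $A$. (1) If $\mathcal F$ is strictly norming, then $$\operatorname{Spec}(T)=\bigcup_{\phi\in\mathcal F}\operatorname{Spec}(\phi(T)).$$ (2) If $\mathcal F$ is faithful, then $$\operatorname{Spec}(T)=\overline{\bigcup_{\phi\in\mathcal F}\operatorname{Spec}(\phi(T))}.$$
   Context: A representation of $A$ is a $*$-morphism $\phi:A\to\mathcal L(\mathcal H_\phi)$ into the bounded operators on a Hilbert space. An observable $T$ affiliated to a $C^*$-algebra $A$ is a $*$-morphism $\theta_T:\mathcal C_0(\mathbb R)\to A$. Its spectrum is $$\operatorname{Spec}(T)=\operatorname{Spec}_A(T)=\{\lambda\in\mathbb R : h(\lambda)=0 \text{ for all } h\in\mathcal C_0(\mathbb R)\text{ with }\theta_T(h)=0\}$$ (it may be empty). If $\sigma:A\to B$ is a $*$-morphism of $C^*$-algebras, $\sigma(T)$ denotes the observable affiliated to $B$ given by $\theta_{\sigma(T)}=\sigma\circ\theta_T$; in particular $\phi(T)$ is an observable affiliated to $\mathcal L(\mathcal H_\phi)$ for a representation $\phi$. The closure in (2) is taken in $\mathbb R$. A set $\mathcal F$ of representations of a unital $A$ is strictly norming if for every $a\in A$ there is $\phi\in\mathcal F$ with $\|a\|=\|\phi(a)\|$, and faithful if the direct sum representation $\bigoplus_{\phi\in\mathcal F}\phi$ is injective. *)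

(* Defs.v *)
From HB Require Import structures.
From mathcomp Require Import all_boot all_order all_algebra complex.
From mathcomp Require Import all_classical all_reals all_analysis.
From mathcomp Require Import ring lra.
Set Implicit Arguments.
Unset Strict Implicit.
Unset Printing Implicit Defensive.
Import Order.TTheory GRing.Theory Num.Theory.
Import numFieldNormedType.Exports.
Local Open Scope classical_set_scope.
Local Open Scope complex_scope.
Local Open Scope ring_scope.

Reserved Notation "x ** y" (at level 40, left associativity).
(* Not assumed unital (C_0(R) is not), hence a product of its own rather than
   the one of pzRingType. *)
HB.mixin Record Lmodule_isStarAlgebra (R : realType) A & GRing.Lmodule R[i] A := {
  smul : A -> A -> A;
  star : A -> A;
  smulA : associative smul;
  smulDl : left_distributive smul +%R;
  smulDr : right_distributive smul +%R;
  smulZl : forall (c : R[i]) x y, smul (c *: x) y = c *: smul x y;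
  smulZr : forall (c : R[i]) x y, smul x (c *: y) = c *: smul x y;
  starK : involutive star;
  starD : {morph star : x y / x + y};
  starZ : forall (c : R[i]) x, star (c *: x) = c^* *: star x;
  starM : forall x y, star (smul x y) = smul (star y) (star x)
}.
#[short(type="starAlgType")]
HB.structure Definition StarAlgebra (R : realType) :=
  {A of GRing.Lmodule R[i] A & Lmodule_isStarAlgebra R A}.
Notation "x ** y" := (smul x y) : ring_scope.

(* The norm of a normedModType over R[i] is R[i]-valued; |x| is a nonnegative
   real element of R[i]. *)
HB.mixin Record StarAlgebra_isCStarAlgebra (R : realType) A
    & StarAlgebra R A & CompleteNormedModule R[i] A := {
  normsM : forall x y : A, `|x ** y| <= `|x| * `|y|;
  cstarE : forall x : A, `|star x ** x| = `|x| ^+ 2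
}.
#[short(type="cstarAlgType")]
HB.structure Definition CStarAlgebra (R : realType) :=
  {A of StarAlgebra R A & CompleteNormedModule R[i] A
      & StarAlgebra_isCStarAlgebra R A}.

(* *-morphisms are not assumed to preserve units, nor to be continuous (which is
   automatic; see starMorphism_bounded for morphisms into L(H)). *)
HB.mixin Record isStarMorphism (R : realType) (A B : starAlgType R) (f : A -> B) := {
  smorphM : {morph f : x y / x ** y};
  smorphS : {morph f : x / star x} }.
#[short(type="starMorphism")]
HB.structure Definition StarMorphism (R : realType) (A B : starAlgType R) :=
  {f of @GRing.Linear R[i] A B *:%R f & isStarMorphism R A B f}.

Section comp.
Context (R : realType) (A B D : starAlgType R).
Variables (g : starMorphism B D) (f : starMorphism A B).
Lemma comp_M : {morph g \o f : x y / x ** y}.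
Proof. by move=> x y /=; rewrite !smorphM. Qed.
Lemma comp_S : {morph g \o f : x / star x}.
Proof. by move=> x /=; rewrite !smorphS. Qed.
HB.instance Definition _ := isStarMorphism.Build R A D (g \o f) comp_M comp_S.
End comp.

HB.mixin Record NormedModule_isHilbert (R : realType) H & CompleteNormedModule R[i] H := {
  inner : H -> H -> R[i];
  innerDl : forall x y z, inner (x + y) z = inner x z + inner y z;
  innerZl : forall (c : R[i]) x y, inner (c *: x) y = c * inner x y;
  innerC : forall x y, inner y x = (inner x y)^*;
  inner_norm : forall x, inner x x = `|x| ^+ 2 }.
#[short(type="hilbertType")]
HB.structure Definition Hilbert (R : realType) :=
  {H of CompleteNormedModule R[i] H & NormedModule_isHilbert R H}.

(* Norms of a normedModType over R[i] take values in R[i]; rnorm is the same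
   norm seen in R. *)
Section rnorm.
Context (R : realType) (V : normedModType R[i]).
Implicit Types x y : V.
Definition rnorm x : R := complex.Re `|x|.
Lemma rnormE x : `|x| = (rnorm x)%:C.
Proof. by rewrite RRe_real // ger0_real. Qed.
Lemma rnorm_ge0 x : 0 <= rnorm x.
Proof. by rewrite -lecR -rnormE; exact: normr_ge0. Qed.
Lemma rnorm0_eq0 x : rnorm x = 0 -> x = 0.
Proof. by move=> h; apply/normr0_eq0; rewrite rnormE h. Qed.
Lemma rnorm0 : rnorm (0 : V) = 0.
Proof. by rewrite /rnorm normr0. Qed.
Lemma ler_rnormD x y : rnorm (x + y) <= rnorm x + rnorm y.
Proof. by rewrite -lecR rmorphD /= -!rnormE ler_normD. Qed.
Lemma rnormZ (c : R) x : 0 <= c -> rnorm (c%:C *: x) = c * rnorm x.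
Proof.
move=> c0; apply: complexI; rewrite rmorphM /= -!rnormE normrZ ger0_norm //.
by rewrite -[0]/(0%:C) lecR.
Qed.
Lemma rnormB x y : rnorm (x - y) = rnorm (y - x).
Proof. by rewrite /rnorm distrC. Qed.
End rnorm.

Lemma complex_gt0 (R : realType) (e : R[i]) :
  0 < e -> exists2 d : R, 0 < d & e = d%:C.
Proof.
move=> e0; have /complex_realP[d eE] : e \is Num.real by rewrite gtr0_real.
by exists d => //; rewrite -ltcR -eE.
Qed.

(* C_0(R): complex-valued continuous functions vanishing at infinity, with the
   pointwise operations. Only its *-algebra structure is needed, as *-morphisms
   are algebraic. R[i]^o carries the usual topology of the complex numbers. *)
Section c0.
Variable (R : realType).
Definition c0_pred : {pred R -> R[i]^o} := fun f =>
  `[< continuous f /\ f x @[x --> -oo] --> 0 /\ f x @[x --> +oo] --> 0 >].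
Lemma c0_submod : submod_closed c0_pred.
Proof.
split.
  apply/asboolP; split; first by move=> x; apply: cvg_cst.
  by split; apply: cvg_cst.
move=> c f g /asboolP[cf [fn fp]] /asboolP[cg [gn gp]]; apply/asboolP; split.
  by move=> x; apply: cvgD; [apply: cvgZr; apply: cf|apply: cg].
have lim0 (F : set_system R) (FF : Filter F) : f @ F --> (0 : R[i]^o) ->
    g @ F --> (0 : R[i]^o) -> (c *: f + g) @ F --> (0 : R[i]^o).
  move=> f0 g0.
  rewrite [X in _ --> X](_ : _ = c *: (0 : R[i]^o) + 0); last by rewrite scaler0 addr0.
  by apply: cvgD; [apply: cvgZr; exact: f0|exact: g0].
by split; apply: lim0.
Qed.
HB.instance Definition _ := GRing.isSubmodClosed.Build _ _ c0_pred c0_submod.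
Record C0 := MkC0 { c0_fun :> R -> R[i]^o; c0P : c0_fun \in c0_pred }.
HB.instance Definition _ := [isSub for c0_fun].
HB.instance Definition _ := [Choice of C0 by <:].
HB.instance Definition _ := [SubChoice_isSubLmodule of C0 by <:].
End c0.

Section hilb.
Context (R : realType) (H : hilbertType R).
Implicit Types x y z : H.
Lemma innerDr x y z : inner x (y + z) = inner x y + inner x z.
Proof. by rewrite innerC innerDl rmorphD /= -!innerC. Qed.
Lemma innerZr (c : R[i]) x y : inner x (c *: y) = c^* * inner x y.
Proof. by rewrite innerC innerZl rmorphM /= -!innerC. Qed.

(* Real part of the inner product. *)
Definition innerR x y : R := complex.Re (inner x y).
Lemma innerRxx x : innerR x x = rnorm x ^+ 2.
Proof. by rewrite /innerR inner_norm rnormE -rmorphXn. Qed.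
Lemma innerRC x y : innerR x y = innerR y x.
Proof. by rewrite /innerR innerC; case: (inner y x). Qed.
Lemma innerRDl x y z : innerR (x + y) z = innerR x z + innerR y z.
Proof. by rewrite /innerR innerDl; case: (inner x z) (inner y z) => [a b] [c d]. Qed.
Lemma innerRZl (a : R) x y : innerR (a%:C *: x) y = a * innerR x y.
Proof. by rewrite /innerR innerZl; case: (inner x y) => [b d] /=; rewrite mul0r subr0. Qed.
Lemma innerRDr x y z : innerR x (y + z) = innerR x y + innerR x z.
Proof. by rewrite innerRC innerRDl !(innerRC x). Qed.
Lemma innerRZr (a : R) x y : innerR x (a%:C *: y) = a * innerR x y.
Proof. by rewrite innerRC innerRZl innerRC. Qed.
Lemma innerRNl x y : innerR (- x) y = - innerR x y.
Proof. by rewrite -scaleN1r -[-1]/(-1%:C) -rmorphN innerRZl mulN1r. Qed.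
Lemma innerRNr x y : innerR x (- y) = - innerR x y.
Proof. by rewrite innerRC innerRNl innerRC. Qed.
Lemma ImI x y : complex.Im (inner x y) = innerR x ('i *: y).
Proof.
by rewrite /innerR innerZr conjCi -complexiE; case: (inner x y) => [a b] /=; rewrite !(mulr0, mul0r, oppr0, mul1r, mulN1r, opprK, add0r, sub0r).
Qed.
Lemma innerR_CS x y : innerR x y <= rnorm x * rnorm y.
Proof.
have [/rnorm0_eq0 ->|nx0] := eqVneq (rnorm x) 0.
  by rewrite -[X in innerR X y](scale0r (0 : H)) -[0 : R[i]]/(0%:C) innerRZl mul0r mulr_ge0 // rnorm_ge0.
have [/rnorm0_eq0 ->|ny0] := eqVneq (rnorm y) 0.
  by rewrite -[X in innerR _ X](scale0r (0 : H)) -[0 : R[i]]/(0%:C) innerRZr mul0r mulr_ge0 // rnorm_ge0.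
have nxy : 0 < rnorm x * rnorm y by rewrite mulr_gt0 // lt_neqAle eq_sym ?nx0 ?ny0 rnorm_ge0.
have := sqr_ge0 (rnorm ((rnorm y)%:C *: x - (rnorm x)%:C *: y)).
rewrite -innerRxx !(innerRDl, innerRDr, innerRNl, innerRNr, innerRZl, innerRZr) (innerRC y x) !innerRxx => h.
rewrite -(ler_pM2l nxy); move: h; nra.
Qed.
Lemma innerR_eq0 y : (forall x, innerR x y = 0) -> y = 0.
Proof. by move=> /(_ y); rewrite innerRxx => /eqP; rewrite sqrf_eq0 => /eqP/rnorm0_eq0. Qed.
Lemma inner_inj y z : (forall x, inner x y = inner x z) -> y = z.
Proof.
move=> h; apply/eqP; rewrite -subr_eq0; apply/eqP/innerR_eq0 => x.
by rewrite innerRDr innerRNr /innerR h subrr.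
Qed.

Lemma riesz (f : H -> R[i]) : (forall c x y, f (c *: x + y) = c * f x + f y) ->
  (exists M : R, forall x, `|f x| <= M%:C * `|x|) ->
  exists y, forall x, f x = inner x y.
Proof.
move=> fl [M fM].
pose g x : R := complex.Re (f x).
have gD x y : g (x + y) = g x + g y.
  by rewrite /g -[x in f (x + y)]scale1r fl mul1r; case: (f x) (f y) => [a b] [c d].
have f0 : f 0 = 0.
  by have := fl (-1) 0 0; rewrite scaler0 addr0 mulN1r addNr.
have gZ a x : g (a%:C *: x) = a * g x.
  by rewrite /g -[_ *: x]addr0 fl f0 addr0; case: (f x) => [b c] /=; rewrite mul0r subr0.
have gM x : `|g x| <= M * rnorm x.
  rewrite -lecR rmorphM /= -rnormE; apply: le_trans (fM x).
  exact: normc_ge_Re.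
pose J x := rnorm x ^+ 2 - 2 * g x.
have J_ge x : - M ^+ 2 <= J x.
  have := gM x; rewrite ler_norml => /andP[_ h]; rewrite /J.
  have := sqr_ge0 (rnorm x - M); nra.
have JD x v t : J (x + t%:C *: v) =
    J x + 2 * t * (innerR x v - g v) + t ^+ 2 * rnorm v ^+ 2.
  rewrite /J -!innerRxx !(innerRDl, innerRDr, innerRZl, innerRZr) (innerRC v x) gD gZ; ring.
have Jpar x y : J x + J y = 2 * J ((2^-1)%:C *: (x + y)) + 2^-1 * rnorm (x - y) ^+ 2.
  rewrite /J -!innerRxx !(innerRDl, innerRDr, innerRZl, innerRZr, innerRNl, innerRNr) (innerRC y x) !gZ !gD; by field.
pose m := inf (range J).
have hJ : has_inf (range J).
  split; first by exists (J 0), 0.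
  by exists (- M ^+ 2) => _ [w _ <-]; exact: J_ge.
have mJ w : m <= J w by apply: (ge_inf hJ.2); exists w.
have /boolp.choice[u uJ] (n : nat) : exists x, J x < m + n.+1%:R^-1.
  have /(inf_adherent)/(_ hJ)[_ [w _ <-] ?] : 0 < n.+1%:R^-1 :> R by [].
  by exists w.
clear hJ J_ge; clearbody m J.
have u_close n k : rnorm (u n - u k) ^+ 2 <= 2 * (n.+1%:R^-1 + k.+1%:R^-1).
  have := Jpar (u n) (u k); have := mJ ((2^-1)%:C *: (u n + u k)).
  have := uJ n; have := uJ k.
  move: (rnorm _ ^+ 2) (J (u n)) (J (u k)) (J _) (n.+1%:R^-1) (k.+1%:R^-1).
  move=> D a b c en ek; lra.
have eps_small (e : R) : 0 < e -> exists N : nat, forall n, (N <= n)%N -> n.+1%:R^-1 < e.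
  move=> e0; exists (Num.truncn e^-1) => n Nn.
  rewrite invf_plt ?posrE //; apply: lt_le_trans (truncnS_gt _) _.
  by rewrite ler_nat ltnS.
have cu : cauchy (u @ \oo).
  apply/cauchy_ballP => e e0.
  have [d d0 eE] : exists2 d : R, 0 < d & e = d%:C.
    have /complex_realP[d eE] : e \is Num.real by rewrite gtr0_real.
    by exists d => //; rewrite -ltcR -eE.
  have [N NP] := eps_small (d ^+ 2 / 4) (divr_gt0 (exprn_gt0 2 d0) (ltr0n _ 4)).
  exists ([set x | exists2 n, (N <= n)%N & x = u n], [set x | exists2 n, (N <= n)%N & x = u n]).
    by split => /=; exists N => // n /= Nn; exists n.
  move=> [_ _] [/= [n Nn ->] [k Nk ->]].
  rewrite -ball_normE /ball_/= eE rnormE ltcR.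
  rewrite -(ltr_pXn2r (n := 2)) ?nnegrE ?rnorm_ge0 ?(ltW d0)//.
  apply: le_lt_trans (u_close _ _) _; have := NP _ Nn; have := NP _ Nk.
  move: (n.+1%:R^-1) (k.+1%:R^-1) (d ^+ 2) => en ek dd; lra.
have [z uz] : exists z : H, u @ \oo --> z by apply/cvg_ex; exact: cauchy_cvg.
have uz_small (e : R) : 0 < e -> \forall n \near \oo, rnorm (z - u n) < e.
  move=> e0; have : 0 < e%:C by rewrite -[0]/(0%:C) ltcR.
  move/cvgrPdist_lt: uz => /[apply]; apply: filterS => n.
  by rewrite rnormE ltcR.
have key v : innerR z v = g v.
  apply/eqP; rewrite -subr_eq0 -normr_eq0 eq_le normr_ge0 andbT.
  apply/ler_addgt0Pr => e e0; rewrite add0r.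
  pose K := 1 + rnorm v.
  have K0 : 0 < K by rewrite ltr_pwDl ?rnorm_ge0.
  pose t := e / K ^+ 2 / 2.
  have K1 : 1 <= K by rewrite lerDl rnorm_ge0.
  have t0 : 0 < t by rewrite !divr_gt0 // exprn_gt0.
  have eK : 0 < e / K / 4 by rewrite !divr_gt0.
  have tt : 0 < t ^+ 2 * K ^+ 2 / 2 by rewrite divr_gt0 // mulr_gt0 // exprn_gt0.
  have [N1 HN1] := eps_small _ tt.
  have [N2 _ HN2] := uz_small _ eK.
  pose n := maxn N1 N2.
  have h1 := HN1 n (leq_maxl _ _); have h2 := HN2 n (leq_maxr _ _).
  have := mJ (u n + t%:C *: v); have := mJ (u n + (- t)%:C *: v).
  rewrite !JD; have := uJ n => h3 h4 h5.
  have c1 := innerR_CS (z - u n) v; have c2 := innerR_CS (u n - z) v.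
  have nN : rnorm (u n - z) = rnorm (z - u n) by rewrite /rnorm distrC.
  rewrite nN in c2.
  have c3 : rnorm (z - u n) * rnorm v <= e / 4.
    have -> : e / 4 = e / K / 4 * K by field; rewrite gt_eqF.
    apply: ler_pM; rewrite ?rnorm_ge0 ?(ltW h2) // /K; lra.
  have c4 : t * K ^+ 2 = e / 2 by rewrite /t; field; rewrite gt_eqF.
  clearbody t.
  have c5 : t ^+ 2 * rnorm v ^+ 2 <= t ^+ 2 * K ^+ 2.
    by rewrite ler_pM2l ?exprn_gt0 // ler_pXn2r ?nnegrE ?rnorm_ge0 ?(ltW K0) // /K lerDr.
  have c6 : t ^+ 2 * K ^+ 2 = t * (e / 2) by rewrite -c4; ring.
  rewrite !innerRDl !innerRNl in c1 c2.
  have sqN : (- t) ^+ 2 = t ^+ 2 by rewrite sqrrN.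
  move: h1 h3 h4 h5 c5 c6; rewrite sqN mulrN !mulNr.
  move: (n.+1%:R^-1) (t ^+ 2 * K ^+ 2) (t ^+ 2 * rnorm v ^+ 2) (J (u n)) => en a b Jn.
  have [q qE] : exists q, q = t * (innerR (u n) v - g v) by eexists.
  rewrite -!mulrA -!qE => h1 h3 h4 h5 c5 c6.
  have c7 : innerR (u n) v - g v <= e * 3 / 8.
    rewrite -(ler_pM2l t0) -qE; move: c6 h1 h3 h4 h5 c5; rewrite !mulrA.
    have [te teE] : exists te, te = t * e by eexists.
    rewrite -!teE; lra.
  have c8 : - (innerR (u n) v - g v) <= e * 3 / 8.
    rewrite -(ler_pM2l t0) mulrN -qE; move: c6 h1 h3 h4 h5 c5; rewrite !mulrA.
    have [te teE] : exists te, te = t * e by eexists.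
    rewrite -!teE; lra.
  rewrite ler_norml; apply/andP; split; lra.
exists z => x; apply/eqP; rewrite eq_complex; apply/andP; split.
  by rewrite -/(g x) -key innerRC.
rewrite ImI.
have -> : complex.Im (f x) = g (- 'i *: x).
  rewrite /g -[_ *: x]addr0 fl f0 addr0 -complexiE.
  by case: (f x) => a b /=; rewrite !(mulr0, mul0r, oppr0, mul1r, mulN1r, opprK, add0r, sub0r).
by rewrite -key [innerR z _]innerRC /innerR innerZr innerZl conjCi.
Qed.
End hilb.

Section c0star.
Variable R : realType.
Implicit Types f g : C0 R.

Lemma C0E f : [/\ continuous f, f x @[x --> -oo] --> (0 : R[i]^o)
  & f x @[x --> +oo] --> (0 : R[i]^o)].
Proof. by have /asboolP[? []] := c0P f. Qed.

Lemma C0_ext f g : (forall x, f x = g x) -> f = g.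
Proof. by move=> fg; apply/val_inj/funext. Qed.

Lemma cvg_conj (F : set_system R) (FF : Filter F) (f : R -> R[i]^o) (a : R[i]^o) :
  f @ F --> a -> (fun x => (f x)^* : R[i]^o) @ F --> (a^* : R[i]^o).
Proof.
move=> fa; apply/cvgrPdist_lt => e e0.
move/cvgrPdist_lt: fa => /(_ e e0); apply: filterS => x.
by rewrite -rmorphB norm_conjC.
Qed.

Lemma C0_mul_subproof f g : (fun x => f x * g x : R[i]^o) \in @c0_pred R.
Proof.
have [cf fn fp] := C0E f; have [cg gn gp] := C0E g.
apply/asboolP; split; first by move=> x; exact: (cvgM (cf x) (cg x)).
have z : (0 : R[i]^o) = (0 : R[i]^o) * 0 by rewrite mulr0.
by split; rewrite [X in _ --> X]z; [exact: (cvgM fn gn) | exact: (cvgM fp gp)].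
Qed.
Definition C0_mul f g : C0 R := MkC0 (C0_mul_subproof f g).

Lemma C0_star_subproof f : (fun x => (f x)^* : R[i]^o) \in @c0_pred R.
Proof.
have [cf fn fp] := C0E f.
apply/asboolP; split; first by move=> x; apply: cvg_conj; exact: cf.
have z : (0 : R[i]^o) = (0 : R[i])^* by rewrite conjC0.
by split; rewrite [X in _ --> X]z; apply: cvg_conj.
Qed.
Definition C0_star f : C0 R := MkC0 (C0_star_subproof f).

Fact C0_mulA : associative C0_mul.
Proof. by move=> f g h; apply: C0_ext => x; exact: mulrA. Qed.
Fact C0_mulDl : left_distributive C0_mul +%R.
Proof. by move=> f g h; apply: C0_ext => x; exact: mulrDl. Qed.
Fact C0_mulDr : right_distributive C0_mul +%R.
Proof. by move=> f g h; apply: C0_ext => x; exact: mulrDr. Qed.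
Fact C0_mulZl (c : R[i]) f g : C0_mul (c *: f) g = c *: C0_mul f g.
Proof. by apply: C0_ext => x; rewrite /= -mulrA. Qed.
Fact C0_mulZr (c : R[i]) f g : C0_mul f (c *: g) = c *: C0_mul f g.
Proof. by apply: C0_ext => x; exact: mulrCA. Qed.
Fact C0_starK : involutive C0_star.
Proof. by move=> f; apply: C0_ext => x; exact: conjCK. Qed.
Fact C0_starD : {morph C0_star : f g / f + g}.
Proof. by move=> f g; apply: C0_ext => x; exact: rmorphD. Qed.
Fact C0_starZ (c : R[i]) f : C0_star (c *: f) = c^* *: C0_star f.
Proof. by apply: C0_ext => x; rewrite /= rmorphM. Qed.
Fact C0_starM f g : C0_star (C0_mul f g) = C0_mul (C0_star g) (C0_star f).
Proof. by apply: C0_ext => x; rewrite /= rmorphM mulrC. Qed.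
HB.instance Definition _ := Lmodule_isStarAlgebra.Build R (C0 R)
  C0_mulA C0_mulDl C0_mulDr C0_mulZl C0_mulZr C0_starK C0_starD C0_starZ C0_starM.
End c0star.

(* L(H): bounded linear operators, a C*-algebra for composition, the Hilbert
   adjoint (from the Riesz representation theorem) and the operator norm. *)
Section bounded_op.
Context (R : realType) (H : hilbertType R).
Definition bounded_op_pred : {pred H -> H} := fun f =>
  `[< (forall (c : R[i]) x y, f (c *: x + y) = c *: f x + f y) /\
      exists M : R, forall x, `|f x| <= M%:C * `|x| >].
Lemma bounded_op_submod : submod_closed bounded_op_pred.
Proof.
split.
  apply/asboolP; split=> [c x y|]; first by rewrite scaler0 addr0.
  by exists 0 => x; rewrite normr0 mul0r.
move=> c f g /asboolP[lf [M fM]] /asboolP[lg [N gN]]; apply/asboolP; split.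
  move=> d x y; rewrite !fctE lf lg !scalerDr !scalerA (mulrC c).
  by rewrite addrACA.
have /complex_realP[k kE] : `|c| \is Num.real by rewrite ger0_real.
exists (k * M + N) => x; rewrite !fctE rmorphD rmorphM mulrDl.
by rewrite (le_trans (ler_normD _ _))// lerD// normrZ kE -mulrA ler_wpM2l// -kE.
Qed.
HB.instance Definition _ := GRing.isSubmodClosed.Build _ _ bounded_op_pred bounded_op_submod.
Record bounded_op := BoundedOp { bounded_op_fun :> H -> H; bounded_opP : bounded_op_fun \in bounded_op_pred }.
HB.instance Definition _ := [isSub for bounded_op_fun].
HB.instance Definition _ := [Choice of bounded_op by <:].
HB.instance Definition _ := [SubChoice_isSubLmodule of bounded_op by <:].
End bounded_op.

Section bopstar.
Context (R : realType) (H : hilbertType R).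
Implicit Types f g h : bounded_op H.
Lemma bounded_opL f (c : R[i]) x y : f (c *: x + y) = c *: f x + f y.
Proof. by have /asboolP[] := bounded_opP f. Qed.
Lemma bounded_op_bounded f : exists M : R, forall x, `|f x| <= M%:C * `|x|.
Proof. by have /asboolP[] := bounded_opP f. Qed.
Lemma bounded_op_bounded0 f : exists2 M : R, 0 <= M & forall x, `|f x| <= M%:C * `|x|.
Proof.
have [M fM] := bounded_op_bounded f; exists `|M|; first exact: normr_ge0.
by move=> x; rewrite (le_trans (fM x)) // ler_wpM2r // lecR ler_norm.
Qed.
Lemma bounded_op0 f : f 0 = 0.
Proof. by have := bounded_opL f (-1) 0 0; rewrite scaler0 addr0 scaleN1r addNr. Qed.
Lemma bounded_opD f x y : f (x + y) = f x + f y.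
Proof. by have := bounded_opL f 1 x y; rewrite !scale1r. Qed.
Lemma bounded_opZ f (c : R[i]) x : f (c *: x) = c *: f x.
Proof. by have := bounded_opL f c x 0; rewrite !addr0 bounded_op0 addr0. Qed.
Lemma bounded_op_ext f g : (forall x, f x = g x) -> f = g.
Proof. by move=> fg; apply/val_inj/funext. Qed.

Lemma bounded_op_comp_subproof f g : f \o g \in @bounded_op_pred R H.
Proof.
apply/asboolP; split=> [c x y|]; first by rewrite /= !bounded_opL.
have [M M0 fM] := bounded_op_bounded0 f; have [N _ gN] := bounded_op_bounded0 g.
exists (M * N) => x; rewrite (le_trans (fM _)) // rmorphM -mulrA.
by rewrite ler_wpM2l // -[0]/(0%:C) lecR.
Qed.
Definition bounded_op_comp f g : bounded_op H := BoundedOp (bounded_op_comp_subproof f g).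

Lemma adjoint_ex f y : exists z, forall x, inner (f x) y = inner x z.
Proof.
apply: riesz => [c u v|]; first by rewrite bounded_opL innerDl innerZl.
have [M M0 fM] := bounded_op_bounded0 f.
have CS (u v : H) : `|inner u v| <= (rnorm u * rnorm v)%:C.
  have [->|nz] := eqVneq (inner u v) 0.
    by rewrite normr0 -[0]/(0%:C) lecR mulr_ge0 ?rnorm_ge0.
  pose c := (inner u v)^* / `|inner u v|.
  have c1 : `|c| = 1.
    by rewrite normrM normfV normr_id norm_conjC divff ?normr_eq0.
  have cI : inner (c *: u) v = `|inner u v|.
    by rewrite innerZl /c mulrAC -normCKC expr2 mulfK ?normr_eq0.
  have := innerR_CS (c *: u) v; rewrite /innerR cI.
  have -> : rnorm (c *: u) = rnorm u by rewrite /rnorm normrZ c1 mul1r.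
  by rewrite -lecR RRe_real ?ger0_real.
exists (M * rnorm y) => x; rewrite (le_trans (CS _ _)) //.
rewrite !rmorphM /= -!rnormE mulrAC ler_wpM2r //.
Qed.
Definition adjf f y : H := projT1 (cid (adjoint_ex f y)).
Lemma adjfE f x y : inner (f x) y = inner x (adjf f y).
Proof. exact: (projT2 (cid (adjoint_ex f y))). Qed.

Lemma bounded_op_adj_subproof f : adjf f \in @bounded_op_pred R H.
Proof.
apply/asboolP; split=> [c x y|].
  apply: inner_inj => z; rewrite -adjfE !innerDr !innerZr -!adjfE //.
have [M M0 fM] := bounded_op_bounded0 f.
exists M => y; rewrite rnormE (rnormE y) -rmorphM lecR.
have [->|n0] := eqVneq (rnorm (adjf f y)) 0; first by rewrite mulr_ge0 ?rnorm_ge0.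
have np : 0 < rnorm (adjf f y) by rewrite lt_neqAle eq_sym n0 rnorm_ge0.
rewrite -(ler_pM2l np) -expr2 -innerRxx /innerR -adjfE.
apply: le_trans (innerR_CS _ _) _; rewrite mulrA ler_wpM2r ?rnorm_ge0 // mulrC.
by rewrite -lecR rmorphM /= -!rnormE.
Qed.
Definition bounded_op_adj f : bounded_op H := BoundedOp (bounded_op_adj_subproof f).
Lemma bounded_op_adjE f x y : inner (f x) y = inner x (bounded_op_adj f y).
Proof. exact: adjfE. Qed.

Fact bounded_op_mulA : associative bounded_op_comp.
Proof. by move=> f g h; apply: bounded_op_ext. Qed.
Fact bounded_op_mulDl : left_distributive bounded_op_comp +%R.
Proof. by move=> f g h; apply: bounded_op_ext. Qed.
Fact bounded_op_mulDr : right_distributive bounded_op_comp +%R.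
Proof. by move=> f g h; apply: bounded_op_ext => x; exact: bounded_opD. Qed.
Fact bounded_op_mulZl (c : R[i]) f g : bounded_op_comp (c *: f) g = c *: bounded_op_comp f g.
Proof. by apply: bounded_op_ext. Qed.
Fact bounded_op_mulZr (c : R[i]) f g : bounded_op_comp f (c *: g) = c *: bounded_op_comp f g.
Proof. by apply: bounded_op_ext => x; exact: bounded_opZ. Qed.
Fact bounded_op_starK : involutive bounded_op_adj.
Proof.
move=> f; apply: bounded_op_ext => y; apply: inner_inj => x.
by rewrite -bounded_op_adjE innerC -bounded_op_adjE -innerC.
Qed.
Fact bounded_op_starD : {morph bounded_op_adj : f g / f + g}.
Proof.
move=> f g; apply: bounded_op_ext => y; apply: inner_inj => x.
by rewrite -bounded_op_adjE innerDl innerDr -!bounded_op_adjE.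
Qed.
Fact bounded_op_starZ (c : R[i]) f : bounded_op_adj (c *: f) = c^* *: bounded_op_adj f.
Proof.
apply: bounded_op_ext => y; apply: inner_inj => x.
by rewrite -bounded_op_adjE innerZl innerZr conjCK -!bounded_op_adjE.
Qed.
Fact bounded_op_starM f g : bounded_op_adj (bounded_op_comp f g) = bounded_op_comp (bounded_op_adj g) (bounded_op_adj f).
Proof.
apply: bounded_op_ext => y; apply: inner_inj => x.
by rewrite -bounded_op_adjE /= -!bounded_op_adjE.
Qed.
HB.instance Definition _ := Lmodule_isStarAlgebra.Build R (bounded_op H)
  bounded_op_mulA bounded_op_mulDl bounded_op_mulDr bounded_op_mulZl bounded_op_mulZr bounded_op_starK bounded_op_starD bounded_op_starZ bounded_op_starM.
End bopstar.

Section bopnorm.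
Context (R : realType) (H : hilbertType R).
Implicit Types f g : bounded_op H.
Definition opnorm f : R := sup [set rnorm (f x) | x in [set x | rnorm x <= 1]].

Lemma bounded_op_rnorm f : exists2 M : R, 0 <= M & forall x, rnorm (f x) <= M * rnorm x.
Proof.
have [M M0 fM] := bounded_op_bounded0 f; exists M => // x.
by rewrite -lecR rmorphM /= -!rnormE.
Qed.

Lemma opnorm_has_sup f : has_sup [set rnorm (f x) | x in [set x | rnorm x <= 1]].
Proof.
split; first by exists (rnorm (f 0)); exists 0 => //=; rewrite rnorm0.
have [M M0 fM] := bounded_op_rnorm f; exists M => _ [x /= x1 <-].
by rewrite (le_trans (fM x)) // ler_piMr.
Qed.
Lemma opnorm_le f (M : R) : 0 <= M -> (forall x, rnorm (f x) <= M * rnorm x) -> opnorm f <= M.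
Proof.
move=> M0 fM; apply: ge_sup; first by have [] := opnorm_has_sup f.
by move=> _ [x /= x1 <-]; rewrite (le_trans (fM x)) // ler_piMr.
Qed.
Lemma opnorm_ge0 f : 0 <= opnorm f.
Proof.
apply: (le_trans (rnorm_ge0 (f 0))); apply: (ub_le_sup (opnorm_has_sup f).2).
by exists 0 => //=; rewrite rnorm0.
Qed.
Lemma opnormP f x : rnorm (f x) <= opnorm f * rnorm x.
Proof.
have [/rnorm0_eq0 ->|x0] := eqVneq (rnorm x) 0; first by rewrite bounded_op0 rnorm0 mulr0.
have xp : 0 < rnorm x by rewrite lt_neqAle eq_sym x0 rnorm_ge0.
have xi : 0 <= (rnorm x)^-1 by rewrite invr_ge0 rnorm_ge0.
have : rnorm (f ((rnorm x)^-1%:C *: x)) <= opnorm f.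
  apply: (ub_le_sup (opnorm_has_sup f).2); exists ((rnorm x)^-1%:C *: x) => //=.
  by rewrite rnormZ // mulVf.
by rewrite bounded_opZ rnormZ // mulrC ler_pdivrMr.
Qed.

Lemma opnormB f g x : rnorm (f x - g x) <= opnorm (f - g) * rnorm x.
Proof. exact: (opnormP (f - g) x). Qed.

Definition bounded_op_norm f : R[i] := (opnorm f)%:C.
Fact bounded_op_normD f g : bounded_op_norm (f + g) <= bounded_op_norm f + bounded_op_norm g.
Proof.
rewrite /bounded_op_norm -rmorphD lecR; apply: opnorm_le; first by rewrite addr_ge0 ?opnorm_ge0.
move=> x; rewrite mulrDl; apply: (le_trans (ler_rnormD _ _)).
by apply: lerD; exact: opnormP.
Qed.
Fact bounded_op_normZ (c : R[i]) f : bounded_op_norm (c *: f) = `|c| * bounded_op_norm f.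
Proof.
have [k cE] : exists k : R, `|c| = k%:C.
  by exists (complex.Re `|c|); rewrite RRe_real ?ger0_real.
have k0 : 0 <= k by rewrite -lecR -cE; exact: normr_ge0.
have nrc (x : H) : rnorm (c *: x) = k * rnorm x.
  by apply: complexI; rewrite rmorphM /= -!rnormE normrZ cE.
rewrite /bounded_op_norm cE -rmorphM; congr (_%:C); apply/eqP; rewrite eq_le.
apply/andP; split.
  apply: opnorm_le; first by rewrite mulr_ge0 ?opnorm_ge0.
  by move=> x; rewrite [X in rnorm X]/(c *: f x) nrc -mulrA ler_wpM2l // opnormP.
have [->|kn0] := eqVneq k 0; first by rewrite mul0r opnorm_ge0.
have kp : 0 < k by rewrite lt_neqAle eq_sym kn0.
rewrite mulrC -ler_pdivlMr //; apply: opnorm_le; first by rewrite divr_ge0 ?opnorm_ge0.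
move=> x; rewrite mulrAC ler_pdivlMr // mulrC -nrc.
exact: (opnormP (c *: f) x).
Qed.
Fact bounded_op_norm0 f : bounded_op_norm f = 0 -> f = 0.
Proof.
move=> /complexI f0; apply: bounded_op_ext => x; apply/rnorm0_eq0/eqP.
by rewrite eq_le rnorm_ge0 andbT (le_trans (opnormP f x)) // f0 mul0r.
Qed.
HB.instance Definition _ := @Lmodule_isNormed.Build R[i] (bounded_op H) bounded_op_norm
  bounded_op_normD bounded_op_normZ bounded_op_norm0.
Lemma bounded_op_normE f : `|f| = (opnorm f)%:C. Proof. by []. Qed.

Lemma bounded_op_complete (F : set_system (bounded_op H)) : ProperFilter F -> cauchy F -> cvg F.
Proof.
move=> FF cF.
have cF' (e : R) : 0 < e -> exists f0 : bounded_op H, F [set f | opnorm (f0 - f) < e].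
  move=> e0; have /cauchyP/(_ e%:C) := cF.
  case; first by rewrite -[0]/(0%:C) ltcR.
  move=> f0 Ff0; exists f0; apply: filterS Ff0 => f.
  by rewrite -ball_normE /ball_/= bounded_op_normE ltcR.
have lim x : exists y : H, (fun f : bounded_op H => f x) @ F --> y.
  suff cx : cauchy ((fun f : bounded_op H => f x) @ F).
    by apply/cvg_ex; exact: cauchy_cvg.
  apply/cauchyP => e /complex_gt0[d d0 ->].
  have K0 : 0 < rnorm x + 1 by rewrite ltr_wpDl ?rnorm_ge0.
  have [f0 Ff0] := cF' _ (divr_gt0 d0 K0).
  exists (f0 x).
  suff : F [set f : bounded_op H | ball (f0 x) d%:C (f x)] by [].
  apply: filterS Ff0 => f /= hf; rewrite -ball_normE /ball_/= rnormE ltcR.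
  apply: le_lt_trans (opnormB f0 f x) _.
  apply: (@le_lt_trans _ _ (d / (rnorm x + 1) * rnorm x)).
    by rewrite ler_wpM2r ?rnorm_ge0 // ltW.
  by rewrite mulrAC ltr_pdivrMr // ltr_pM2l // ltrDl.
have [g gP] := boolp.choice lim.
have gl (c : R[i]) x y : g (c *: x + y) = c *: g x + g y.
  apply: (cvg_unique _ (gP (c *: x + y))); first exact: norm_hausdorff.
  have -> : (fun f : bounded_op H => f (c *: x + y)) = (fun f => c *: f x + f y).
    by apply/funext => f; rewrite bounded_opL.
  by apply: cvgD; [apply: cvgZr; exact: gP|exact: gP].
have close (e : R) f0 : F [set f | opnorm (f0 - f) < e] ->
    forall x, rnorm (f0 x - g x) <= e * rnorm x.
  move=> Ff0 x; apply/ler_addgt0Pr => d d0.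
  have d0' : 0 < d%:C by rewrite -[0]/(0%:C) ltcR.
  have /cvgrPdist_lt/(_ _ d0') Fd := gP x.
  have [f [/= f1 f2]] := filter_ex (filterI Ff0 Fd).
  rewrite -(subrKA (f x)) (le_trans (ler_rnormD _ _)) // lerD //.
    by apply: (le_trans (opnormB f0 f x)); rewrite ler_wpM2r ?rnorm_ge0 // ltW.
  by rewrite /rnorm distrC -/(rnorm _) -lecR -rnormE ltW.
have g_mem : g \in @bounded_op_pred R H.
  apply/asboolP; split=> //.
  have [f0 Ff0] := cF' 1 ltr01; have cl := close _ _ Ff0.
  exists (1 + opnorm f0) => x; rewrite rnormE (rnormE x) -rmorphM lecR.
  rewrite -[g x](subrK (f0 x)) (le_trans (ler_rnormD _ _)) // mulrDl lerD ?opnormP //.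
  by rewrite /rnorm distrC -/(rnorm _) cl.
apply/cvg_ex; exists (BoundedOp g_mem); apply/cvgrPdist_lt => e /complex_gt0[d d0 ->].
have d2 : 0 < d / 2 by rewrite divr_gt0.
have [f0 Ff0] := cF' _ d2; have cl := close _ _ Ff0.
apply: filterS (Ff0) => f /= hf.
rewrite -(subrKA f0) (le_lt_trans (ler_normD _ _)) //.
rewrite [d]splitr rmorphD /= ler_ltD //.
  rewrite distrC bounded_op_normE lecR; apply: opnorm_le; first exact: ltW.
  by move=> x; exact: cl.
by rewrite bounded_op_normE ltcR.
Qed.
HB.instance Definition _ := Uniform_isComplete.Build (bounded_op H) bounded_op_complete.

Fact bounded_op_normsM f g : `|f ** g| <= `|f| * `|g|.
Proof.
rewrite !bounded_op_normE -rmorphM lecR; apply: opnorm_le; first by rewrite mulr_ge0 ?opnorm_ge0.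
move=> x; apply: (le_trans (opnormP f (g x))).
by rewrite -mulrA ler_wpM2l ?opnorm_ge0 ?opnormP.
Qed.
Lemma opnorm_le_sq f (M : R) : 0 <= M -> (forall x, rnorm (f x) ^+ 2 <= M * rnorm x ^+ 2) ->
  opnorm f ^+ 2 <= M.
Proof.
move=> M0 fM; have : opnorm f <= Num.sqrt M.
  apply: opnorm_le => [|x]; first exact: sqrtr_ge0.
  rewrite -(@ler_pXn2r _ 2) ?nnegrE ?rnorm_ge0 ?mulr_ge0 ?sqrtr_ge0 ?rnorm_ge0 //.
  by rewrite exprMn sqr_sqrtr.
by rewrite -(@ler_pXn2r _ 2) ?nnegrE ?opnorm_ge0 ?sqrtr_ge0 // sqr_sqrtr.
Qed.
Lemma opnorm_sq f : opnorm f ^+ 2 <= opnorm (star f ** f).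
Proof.
apply: opnorm_le_sq => [|x]; first exact: opnorm_ge0.
rewrite -innerRxx /innerR bounded_op_adjE (le_trans (innerR_CS _ _)) //.
by rewrite expr2 mulrA mulrC ler_wpM2r ?rnorm_ge0 // (opnormP (star f ** f)).
Qed.
Lemma opnorm_star_le f : opnorm (star f) <= opnorm f.
Proof.
have [f0|f0] := eqVneq (opnorm (star f)) 0; first by rewrite f0 opnorm_ge0.
have fp : 0 < opnorm (star f) by rewrite lt_neqAle eq_sym f0 opnorm_ge0.
rewrite -(ler_pM2l fp) -expr2 (le_trans (opnorm_sq _)) // starK.
by rewrite -lecR rmorphM /= mulrC; exact: bounded_op_normsM.
Qed.
Fact bounded_op_cstarE f : `|star f ** f| = `|f| ^+ 2.
Proof.
rewrite !bounded_op_normE -rmorphXn; congr (_%:C); apply/eqP; rewrite eq_le opnorm_sq andbT.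
rewrite expr2 (@le_trans _ _ (opnorm (star f) * opnorm f)) //.
  by rewrite -lecR rmorphM /=; exact: bounded_op_normsM.
by rewrite ler_wpM2r ?opnorm_ge0 ?opnorm_star_le.
Qed.
HB.instance Definition _ := StarAlgebra_isCStarAlgebra.Build R (bounded_op H) bounded_op_normsM bounded_op_cstarE.
End bopnorm.

Section contraction.
Context (R : realType) (A : cstarAlgType R) (H : hilbertType R).
Implicit Types a b t u v : A.

Lemma rnorm_smul u v : rnorm (u ** v) <= rnorm u * rnorm v.
Proof. by rewrite -lecR rmorphM /= -!rnormE normsM. Qed.
Lemma rnorm_cstar u : rnorm (star u ** u) = rnorm u ^+ 2.
Proof. by apply: complexI; rewrite rmorphXn /= -!rnormE cstarE. Qed.
Lemma rnorm_star_le u : rnorm u <= rnorm (star u).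
Proof.
have [->|u0] := eqVneq (rnorm u) 0; first exact: rnorm_ge0.
have up : 0 < rnorm u by rewrite lt_neqAle eq_sym u0 rnorm_ge0.
rewrite -(ler_pM2r up) -expr2 -rnorm_cstar; exact: rnorm_smul.
Qed.
Lemma rnorm_star u : rnorm (star u) = rnorm u.
Proof.
apply/eqP; rewrite eq_le rnorm_star_le andbT.
by rewrite (le_trans (rnorm_star_le _)) // starK.
Qed.
Lemma smulN u v : u ** (- v) = - (u ** v).
Proof. by rewrite -scaleN1r smulZr scaleN1r. Qed.
Lemma smulNl u v : (- u) ** v = - (u ** v).
Proof. by rewrite -scaleN1r smulZl scaleN1r. Qed.

Lemma star0 : star (0 : A) = 0.
Proof. by apply: (addrI (star (0 : A))); rewrite -starD !addr0. Qed.
Lemma starN u : star (- u) = - star u.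
Proof. by apply: (addrI (star u)); rewrite -starD !subrr star0. Qed.
Lemma starB u v : star (u - v) = star u - star v.
Proof. by rewrite starD starN. Qed.
Lemma conjC_real (c : R) : (c%:C : R[i])^* = c%:C.
Proof. by apply/CrealP/complex_realP; exists c. Qed.

(* 1 - b has a selfadjoint square root 1 - t when b = b^* and |b| < 1. *)
Lemma sqrt_one_sub b : star b = b -> rnorm b < 1 ->
  exists2 t, star t = t & b = t + t - t ** t.
Proof.
move=> bs b1; pose s := rnorm b; have s0 : 0 <= s := rnorm_ge0 b.
have h0 : 0 <= 2^-1 :> R by rewrite invr_ge0.
pose T t := (2^-1)%:C *: (b + t ** t).
have TB u v : rnorm (T u - T v) <= 2^-1 * (rnorm u + rnorm v) * rnorm (u - v).
  rewrite /T -scalerBr rnormZ // -mulrA ler_wpM2l //.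
  have -> : b + u ** u - (b + v ** v) = u ** (u - v) + (u - v) ** v.
    by rewrite smulDr smulDl smulN smulNl subrKA opprD addrACA subrr add0r.
  rewrite (le_trans (ler_rnormD _ _)) // mulrDl lerD //.
    exact: rnorm_smul.
  by rewrite (le_trans (rnorm_smul _ _)) // mulrC.
pose t n := iter n T 0.
have tS n : t n.+1 = T (t n) by [].
have ts n : rnorm (t n) <= s.
  elim: n => [|n IH]; first by rewrite rnorm0.
  rewrite tS /T rnormZ //.
  have h1 := ler_rnormD b (t n ** t n); have h2 := rnorm_smul (t n) (t n).
  have h3 : rnorm (t n) * rnorm (t n) <= s * s.
    by rewrite ler_pM ?rnorm_ge0.
  have h4 : s * s <= s by rewrite ler_piMr // ltW.
  rewrite -/s in h1; lra.
have tD n k : rnorm (t (n + k)%N - t n) <= s ^+ n * s.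
  elim: n => [|n IH]; first by rewrite subr0 expr0 mul1r ts.
  rewrite addSn !tS (le_trans (TB _ _)) // exprS -[leRHS]mulrA.
  apply: ler_pM => //; rewrite ?rnorm_ge0 //.
    by apply: mulr_ge0 => //; apply: addr_ge0; exact: rnorm_ge0.
  have h1 := ts (n + k)%N; have h2 := ts n; lra.
have sn (e : R) : 0 < e -> exists N : nat, s ^+ N * s < e.
  move=> e0; have : (fun n => s ^+ n) @ \oo --> (0 : R).
    by apply: cvg_expr; rewrite ger0_norm.
  move/cvgrPdist_lt => /(_ _ e0) [N _ /(_ N (leqnn N))].
  rewrite /= sub0r normrN ger0_norm ?exprn_ge0 // => sN.
  by exists N; rewrite (le_lt_trans _ sN) // ler_piMr ?exprn_ge0 // ltW.
have ct : cauchy (t @ \oo).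
  apply/cauchyP => e /complex_gt0[d d0 ->]; have [N sN] := sn d d0.
  exists (t N); exists N => // n /= Nn.
  rewrite -ball_normE /ball_/= rnormE ltcR rnormB.
  by rewrite -(subnKC Nn) (le_lt_trans (tD _ _)).
have [z tz] : exists z : A, t @ \oo --> z by apply/cvg_ex; exact: cauchy_cvg.
have tz_lt (e : R) : 0 < e -> \forall n \near \oo, rnorm (z - t n) < e.
  move=> e0; have : 0 < e%:C by rewrite -[0]/(0%:C) ltcR.
  move/cvgrPdist_lt: tz => /[apply]; apply: filterS => n.
  by rewrite rnormE ltcR.
have small (K : R) v : 0 < K -> (forall n, rnorm v <=
    K * (rnorm (z - t n) + rnorm (z - t n.+1))) -> v = 0.
  move=> K0 hv; apply/rnorm0_eq0/eqP; rewrite eq_le rnorm_ge0 andbT.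
  apply/ler_addgt0Pr => e e0; rewrite add0r.
  have e2 : 0 < e / K / 2 by rewrite !divr_gt0.
  have [N _ HN] := tz_lt _ e2.
  apply: (le_trans (hv N)); rewrite mulrC -ler_pdivlMr //.
  by rewrite [leRHS]splitr lerD // ltW //; apply: HN => /=.
have zT : z = T z.
  apply/eqP; rewrite -subr_eq0; apply/eqP.
  have K0 : 0 < 1 + 2^-1 * (s + rnorm z).
    by rewrite ltr_pwDl // mulr_ge0 // addr_ge0 // rnorm_ge0.
  apply: (small _ _ K0) => n.
  rewrite -(subrKA (t n.+1)) (le_trans (ler_rnormD _ _)) // tS.
  have h1 : rnorm (T (t n) - T z) <= 2^-1 * (s + rnorm z) * rnorm (z - t n).
    rewrite (le_trans (TB _ _)) // (rnormB z) ler_wpM2r ?rnorm_ge0 //.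
    by rewrite ler_wpM2l // lerD2r.
  rewrite mulrDr [in leRHS]addrC lerD //.
    rewrite ler_peMl ?rnorm_ge0 // lerDl mulr_ge0 // addr_ge0 ?rnorm_ge0 //.
  by rewrite (le_trans h1) // ler_wpM2r ?rnorm_ge0 // lerDr.
have tstar n : star (t n) = t n.
  elim: n => [|n IH]; first exact: star0.
  by rewrite tS /T starZ starD starM IH bs conjC_real.
exists z.
  apply/eqP; rewrite -subr_eq0; apply/eqP; apply: (small 2) => // n.
  rewrite -(subrKA (t n)) (le_trans (ler_rnormD _ _)) // (rnormB (t n)).
  rewrite -{1}(tstar n) -starB rnorm_star.
  have := rnorm_ge0 (z - t n.+1); have := rnorm_ge0 (z - t n); lra.
apply/eqP; rewrite eq_sym subr_eq; apply/eqP; rewrite {1 2}zT /T -scalerDl.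
have -> : (2^-1)%:C + (2^-1)%:C = 1 :> R[i].
  by rewrite -rmorphD /= -[2^-1]mul1r -splitr.
by rewrite scale1r.
Qed.

Lemma starMorphism_contracting (phi : starMorphism A (bounded_op H)) a x :
  rnorm a < 1 -> rnorm (phi a x) <= rnorm x.
Proof.
move=> a1.
have [||t ts bE] := @sqrt_one_sub (star a ** a).
- by rewrite starM starK.
- by rewrite rnorm_cstar expr_lt1 // rnorm_ge0.
have ptx (y : H) : innerR (phi t x) y = innerR x (phi t y).
  by rewrite /innerR bounded_op_adjE -[bounded_op_adj _]/(star (phi t)) -smorphS ts.
have : rnorm (phi a x) ^+ 2 = rnorm x ^+ 2 - rnorm (x - phi t x) ^+ 2.
  rewrite -!innerRxx {1}/innerR bounded_op_adjE -/(innerR _ _).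
  have -> : bounded_op_adj (phi a) (phi a x) = phi (star a ** a) x.
    by rewrite smorphM smorphS.
  have -> : phi (star a ** a) x = phi t x + phi t x - phi t (phi t x).
    by rewrite bE raddfB raddfD /= smorphM.
  rewrite !(innerRDl, innerRDr, innerRNl, innerRNr) -(ptx (phi t x)) (innerRC (phi t x) x).
  ring.
move=> h; rewrite -(@ler_pXn2r _ 2) ?nnegrE ?rnorm_ge0 // h.
by rewrite gerBl sqr_ge0.
Qed.

Lemma starMorphism_bounded (phi : starMorphism A (bounded_op H)) a :
  forall x, rnorm (phi a x) <= (rnorm a + 1) * rnorm x.
Proof.
have K0 : 0 < rnorm a + 1 by rewrite ltr_wpDl ?rnorm_ge0.
move=> x.
have Ki : 0 <= (rnorm a + 1)^-1 by rewrite invr_ge0 ltW.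
have := @starMorphism_contracting phi ((rnorm a + 1)^-1%:C *: a) x.
have -> : phi ((rnorm a + 1)^-1%:C *: a) x = (rnorm a + 1)^-1%:C *: phi a x.
  by rewrite linearZ.
rewrite !rnormZ //.
rewrite mulrC ltr_pdivrMr // mul1r ltrDl ltr01 => /(_ isT).
by rewrite mulrC ler_pdivrMr // mulrC.
Qed.
End contraction.

(* Underlying set of the Hilbert direct sum of the H i: square-summable
   families. *)
Record l2sum (R : realType) (I : Type) (H : I -> hilbertType R) := L2sum {
  l2sum_fun :> forall i, H i;
  l2sumP : (\esum_(i in [set: {classic I}]) ((rnorm (l2sum_fun i)) ^+ 2)%:E < +oo)%E
}.

Section direct_sum.
Context (R : realType) (A : cstarAlgType R) (I : Type) (H : I -> hilbertType R).
Variable phi : forall i, starMorphism A (bounded_op (H i)).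

Lemma starMorphism_uniformly_bounded a : exists2 M : R, 0 <= M &
  forall i (x : H i), rnorm (phi i a x) <= M * rnorm x.
Proof.
exists (rnorm a + 1) => [|i x]; first by rewrite addr_ge0 ?rnorm_ge0.
exact: starMorphism_bounded.
Qed.

Lemma direct_sum_subproof a (x : l2sum H) :
  (\esum_(i in [set: {classic I}]) ((rnorm (phi i a (x i))) ^+ 2)%:E < +oo)%E.
Proof.
have [M M0 phiM] := starMorphism_uniformly_bounded a.
set S := (\esum_(i in [set: {classic I}]) ((rnorm (x i)) ^+ 2)%:E)%E.
have S_fin : (S < +oo)%E := l2sumP x.
have S0 : (0 <= S)%E by apply: esum_ge0 => i _; rewrite lee_fin sqr_ge0.
apply: (@le_lt_trans _ _ ((M ^+ 2)%:E * S)%E); last first.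
  by rewrite lte_mul_pinfty // lee_fin sqr_ge0.
apply: ge_ereal_sup => _ [X [Xfin _] <-].
apply: (@le_trans _ _ (\sum_(i \in X) ((M ^+ 2)%:E * ((rnorm (x i)) ^+ 2)%:E))%E).
  rewrite !fsbig_finite //=; apply: lee_sum => i _.
  rewrite -EFinM lee_fin -exprMn ler_pXn2r ?nnegrE ?mulr_ge0 ?rnorm_ge0 //.
rewrite -ge0_mule_fsumr; last by move=> i; rewrite lee_fin sqr_ge0.
by rewrite lee_wpmul2l ?lee_fin ?sqr_ge0 //; apply: ereal_sup_ubound; exists X.
Qed.

(* The direct sum representation: phi i a acts on the i-th component, and the
   result is square-summable because *-morphisms are contracting. *)
Definition direct_sum (a : A) (x : l2sum H) : l2sum H :=
  L2sum (direct_sum_subproof a x).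
End direct_sum.

Section observables.
Context (R : realType).

Definition unital (A : starAlgType R) :=
  exists e : A, forall a, e ** a = a /\ a ** e = a.

Definition observable (A : cstarAlgType R) := starMorphism (C0 R) A.

(* T : observable A is its *-morphism theta_T, so T h is theta_T(h). *)
Definition Spec (A : cstarAlgType R) (T : observable A) : set R :=
  [set l | forall h : C0 R, T h = 0 -> h l = 0].

Definition map_observable (A B : cstarAlgType R) (sigma : starMorphism A B)
  (T : observable A) : observable B := sigma \o T.

Record representation (A : cstarAlgType R) := Representation {
  rep_space : hilbertType R;
  rep_map :> starMorphism A (bounded_op rep_space)
}.

(* A set F of representations is given as a family indexed by a type J: a
   predicate on representation A would range over a proper class (and its
   universe is too large for classical_sets). *)
Definition strictly_norming (A : cstarAlgType R) (J : Type)
    (F : J -> representation A) :=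
  forall a : A, exists j, `|a| = `|F j a|.

Definition faithful (A : cstarAlgType R) (J : Type)
    (F : J -> representation A) :=
  injective (direct_sum (fun j => rep_map (F j))).

End observables.

(* Main.v *)
Require Import Defs.
From mathcomp Require Import all_boot all_order all_algebra complex.
From mathcomp Require Import all_classical all_reals all_analysis.
From mathcomp Require Import ring lra.
Set Implicit Arguments.
Unset Strict Implicit.
Unset Printing Implicit Defensive.
Import Order.TTheory GRing.Theory Num.Theory.
Import numFieldNormedType.Exports.
Local Open Scope classical_set_scope.
Local Open Scope ring_scope.
Local Open Scope complex_scope.

(** The inclusions Spec (phi T) <= Spec T are clear, and Spec T is closed, so
    only the points of Spec T have to be found in the right-hand sides.

    Everything rests on a comparison principle ([observable_mono]): if S is an
    observable affiliated to L(H) and |f| <= |g| pointwise, then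
    |S f x| <= |S g x| for every vector x. Indeed r = sqrt (|g|^2 - |f|^2) is
    in C_0(R) and f^* f + r^* r = g^* g, so that
    |S g x|^2 = |S f x|^2 + |S r x|^2. It has two consequences: |S f x| <= c |x|
    when |f| <= c ([observable_contracting]); and S h = 0 when h vanishes off a
    compact set K disjoint from Spec S ([observable_off_Spec]), because the
    kernel of S contains some g with |g| >= 1 on K, whence |h| <= |g h|.
    They are applied to the tents t_d of height and half-width d at a point l.

    Faithful family: if l in Spec T is not in the closure of the union, some t_d
    is killed by every phi o T, hence by T, although t_d(l) = d <> 0.

    Strictly norming family: let l in Spec T lie in no Spec (phi T), and let phi
    attain the norm of a = T t_1. Some t_d with d < 1 is killed by phi o T, and
    0 <= t_1 - t_d <= 1 - d, hence |a| = |phi (T (t_1 - t_d))| <= 1 - d.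
    On the other hand t_1 >= 1 - d/2 where k = t_(d/2) is nonzero, so for
    every member psi of the family
      (1 - d/2) |psi (T k) x| <= |psi (a ** T k) x| <= (1 - d) |psi (T k) x|.
    Thus psi (T k) = 0 for all psi, so T k = 0, although k(l) = d/2 <> 0. *)

(** * Norms and convergence in the complex numbers *)

Section rnorm_theory.
Context (R : realType).

Lemma rnorm_gt0 (V : normedModType R[i]) (x : V) : x <> 0 -> 0 < rnorm x.
Proof.
by move=> x0; rewrite lt_neqAle rnorm_ge0 andbT eq_sym; apply/eqP => /rnorm0_eq0.
Qed.

Lemma cvg_rnorm (V : normedModType R[i]) (X : Type) (F : set_system X)
    (FF : Filter F) (f : X -> V) (a : V) :
  f @ F --> a -> rnorm (f x) @[x --> F] --> rnorm a.
Proof.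
move=> fa; apply/cvgrPdist_lt => e e0.
have : 0 < e%:C by rewrite -[0]/(0%:C) ltcR.
move/cvgrPdist_lt: fa => /[apply]; apply: filterS => x.
rewrite rnormE ltcR; apply: le_lt_trans.
have := ler_rnormD (a - f x) (f x); have := ler_rnormD (f x - a) a.
by rewrite !subrK (rnormB (f x)) ler_norml => h1 h2; apply/andP; split; lra.
Qed.

Lemma cvg_realC (X : Type) (F : set_system X) (FF : Filter F) (f : X -> R)
    (a : R) :
  f @ F --> a -> ((f x)%:C : R[i]^o) @[x --> F] --> (a%:C : R[i]^o).
Proof.
move=> fa; apply/cvgrPdist_lt => e /complex_gt0[d d0 ->].
move/cvgrPdist_lt: fa => /(_ _ d0); apply: filterS => x h.
by rewrite -rmorphB normc_def /= expr0n addr0 sqrtr_sqr ltcR.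
Qed.

Lemma rnorm_realC (a : R) : rnorm (a%:C : R[i]^o) = `|a|.
Proof. by rewrite /rnorm /= expr0n addr0 sqrtr_sqr. Qed.

Lemma rnormM (a b : R[i]^o) : rnorm (a * b : R[i]^o) = rnorm a * rnorm b.
Proof. by apply: complexI; rewrite rmorphM /= -!rnormE normrM. Qed.

Lemma conjM_rnorm (z : R[i]^o) : z^* * z = (rnorm z ^+ 2)%:C.
Proof. by rewrite -normCKC [`|z|]rnormE rmorphXn. Qed.

End rnorm_theory.

(** * Functions vanishing at infinity *)

Section C0_theory.
Context (R : realType).
Implicit Types (f g : C0 R).

Lemma realC_C0 (r : R -> R) : continuous r -> r x @[x --> -oo] --> (0 : R) ->
  r x @[x --> +oo] --> (0 : R) -> (fun x => (r x)%:C : R[i]^o) \in @c0_pred R.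
Proof.
move=> rc rn rp; apply/asboolP; split; first by move=> x; apply: cvg_realC; exact: rc.
by split; exact: cvg_realC.
Qed.

(** The function r is sqrt (|g|^2 - |f|^2). *)
Lemma C0_pythagoras f g : (forall x, rnorm (f x) <= rnorm (g x)) ->
  exists r : C0 R, star f ** f + star r ** r = star g ** g.
Proof.
move=> fg; pose r x := Num.sqrt (rnorm (g x) ^+ 2 - rnorm (f x) ^+ 2).
(* Covers continuity and both limits at infinity, where sqrt (0 - 0) = 0. *)
have rcvg (F : set_system R) (FF : Filter F) (a b : R[i]^o) : f @ F --> a ->
    g @ F --> b -> r @ F --> Num.sqrt (rnorm b ^+ 2 - rnorm a ^+ 2).
  move=> fa gb; apply: (continuous_cvg _ (@sqrt_continuous R _)).
  have sq (h : R -> R[i]^o) (c : R[i]^o) : h @ F --> c ->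
      rnorm (h x) ^+ 2 @[x --> F] --> rnorm c ^+ 2.
    by move=> /cvg_rnorm hc; exact: (cvgM hc hc).
  by apply: cvgB; exact: sq.
have [cf fn fp] := C0E f; have [cg gn gp] := C0E g.
have z : (0 : R) = Num.sqrt (rnorm (0 : R[i]^o) ^+ 2 - rnorm (0 : R[i]^o) ^+ 2).
  by rewrite subrr sqrtr0.
have rC0 : (fun x => (r x)%:C : R[i]^o) \in @c0_pred R.
  apply: realC_C0; first by move=> x; apply: rcvg; [exact: cf|exact: cg].
    by rewrite [X in _ --> X]z; exact: rcvg.
  by rewrite [X in _ --> X]z; exact: rcvg.
exists (MkC0 rC0); apply: C0_ext => x.
rewrite -[LHS]/((f x)^* * f x + ((r x)%:C)^* * (r x)%:C).
rewrite -[RHS]/((g x)^* * g x) !conjM_rnorm rnorm_realC -rmorphD /=.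
rewrite ger0_norm ?sqrtr_ge0 // sqr_sqrtr ?subrKC //.
by rewrite subr_ge0 ler_pXn2r ?nnegrE ?rnorm_ge0.
Qed.

(** The tent function of height d and half-width d centred at l; the zero
    function when d <= 0. *)
Definition tent (l d x : R) : R := Num.max 0 (d - `|x - l|).

Lemma tent_ge0 l d x : 0 <= tent l d x.
Proof. by rewrite /tent le_max lexx. Qed.

Lemma tent_center l d : 0 <= d -> tent l d l = d.
Proof. by move=> d0; rewrite /tent subrr normr0 subr0; apply/max_idPr. Qed.

Lemma tent_off l d x : d <= `|x - l| -> tent l d x = 0.
Proof. by move=> h; apply/max_idPl; rewrite subr_le0. Qed.

Lemma tent_C0 l d : (fun x => (tent l d x)%:C : R[i]^o) \in @c0_pred R.
Proof.
apply: realC_C0.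
- move=> x; rewrite /tent; apply: (@continuous_max R _ (fun=> 0) (fun x => d - `|x - l|)).
    exact: cvg_cst.
  apply: cvgB; first exact: cvg_cst.
  by apply: cvg_norm; apply: cvgB; [exact: cvg_id|exact: cvg_cst].
- apply: cvg_near_cst; near=> x; apply: tent_off.
  have : x <= l - d by near: x; apply: nbhs_ninfty_le; rewrite num_real.
  move=> h; rewrite distrC; apply: le_trans (ler_norm _); lra.
- apply: cvg_near_cst; near=> x; apply: tent_off.
  have : l + d <= x by near: x; apply: nbhs_pinfty_ge; rewrite num_real.
  move=> h; apply: le_trans (ler_norm _); lra.
Unshelve. all: by end_near. Qed.

(** The tent function as a complex-valued element of C_0(R). *)
Definition C0_tent l d : C0 R := MkC0 (tent_C0 l d).

Lemma C0_tent_ball l d x : C0_tent l d x <> 0 -> `|x - l| < d.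
Proof. by rewrite /= ltNge => h; apply/negP => /tent_off t; apply: h; rewrite t. Qed.

Lemma rnorm_tent l d x : rnorm (C0_tent l d x) = tent l d x.
Proof. by rewrite rnorm_realC ger0_norm ?tent_ge0. Qed.

End C0_theory.

(** * Observables affiliated to the bounded operators on a Hilbert space *)

Section observable_on_H.
Context (R : realType) (H : hilbertType R).
Variable S : starMorphism (C0 R) (bounded_op H).
Implicit Types (f g h : C0 R) (x : H).

Lemma rnorm_starE f x : rnorm (S f x) ^+ 2 = innerR x (S (star f ** f) x).
Proof. by rewrite -innerRxx /innerR bounded_op_adjE smorphM smorphS. Qed.

(** Comparison principle: |S g x|^2 - |S f x|^2 = |S r x|^2 for the r of
    [C0_pythagoras]. *)
Lemma observable_mono f g x : (forall t, rnorm (f t) <= rnorm (g t)) ->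
  rnorm (S f x) <= rnorm (S g x).
Proof.
move=> /C0_pythagoras[r fgr].
rewrite -(@ler_pXn2r _ 2) ?nnegrE ?rnorm_ge0 // [leRHS]rnorm_starE -fgr.
have -> : S (star f ** f + star r ** r) x = S (star f ** f) x + S (star r ** r) x.
  by rewrite linearD.
by rewrite innerRDr -!rnorm_starE lerDl sqr_ge0.
Qed.

(** As |f^* f| <= |c f|, the comparison principle bounds
    |S f x|^2 = <x, S (f^* f) x> by c |S f x| |x|. *)
Lemma observable_contracting f (c : R) x : 0 <= c ->
  (forall t, rnorm (f t) <= c) -> rnorm (S f x) <= c * rnorm x.
Proof.
move=> c0 fc; have [->|n0] := eqVneq (rnorm (S f x)) 0.
  by rewrite mulr_ge0 ?rnorm_ge0.
have np : 0 < rnorm (S f x) by rewrite lt_neqAle eq_sym n0 rnorm_ge0.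
rewrite -(ler_pM2r np) -expr2 rnorm_starE (le_trans (innerR_CS _ _)) //.
rewrite -mulrA mulrCA ler_wpM2l ?rnorm_ge0 //.
rewrite -rnormZ //.
have -> : c%:C *: S f x = S (c%:C *: f) x by rewrite linearZ.
apply: observable_mono => t.
rewrite -[(star f ** f) t]/((f t)^* * f t) -[(_ *: f) t]/(c%:C * f t).
rewrite !rnormM rnorm_realC (ger0_norm c0) ler_wpM2r ?rnorm_ge0 //.
by rewrite [leLHS](_ : _ = rnorm (f t)) // /rnorm norm_conjC.
Qed.

(** The sets {|g| > 1}, for g in the kernel of S, cover K; if g_1, ..., g_n give
    a finite subcover, the sum of the g_i^* g_i is as required. *)
Lemma observable_ker_ge1 (K : set R) : compact K -> K `&` Spec S = set0 ->
  exists2 g, S g = 0 & forall t, K t -> 1 <= rnorm (g t).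
Proof.
move=> cK KS.
have := cK; rewrite compact_cover => /(_ _ [set g : C0 R | S g = 0]
  (fun g => [set t | 1 < rnorm (g t)])) [].
- move=> g _; have [cg _ _] := C0E g.
  rewrite (_ : [set t | _] = (fun t => rnorm (g t)) @^-1` [set u | 1 < u]) //.
  apply: open_comp; last exact: open_gt.
  by move=> t _; apply: cvg_rnorm; exact: cg.
- move=> t Kt; have : ~ Spec S t by move=> St; have : (K `&` Spec S) t by []; rewrite KS.
  move=> /existsNP[g /not_implyP[Sg0 gt0]].
  have gtp := rnorm_gt0 gt0.
  (* Scaling g in the kernel brings |g t| to 2. *)
  exists ((2 / rnorm (g t))%:C *: g); first by rewrite /= linearZ /= Sg0 scaler0.
  change (1 < rnorm ((2 / rnorm (g t))%:C * g t : R[i]^o)).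
  rewrite rnormM rnorm_realC ger0_norm ?divr_ge0 ?ltW //.
  by rewrite divfK ?gt_eqF // ltr1n.
- move=> D DS KD; exists (\sum_(g <- finmap.enum_fset D) star g ** g).
    rewrite linear_sum /= big_seq big1 // => g gD.
    have /set_mem/= Sg0 := DS g gD.
    rewrite smorphM Sg0; apply: bounded_op_ext => x.
    by rewrite -[LHS]/(S (star g) (0 : H)) bounded_op0.
  move=> t /KD[g gD g1].
  have sumE (s : seq (C0 R)) : (\sum_(f <- s) star f ** f) t =
      ((\sum_(f <- s) rnorm (f t) ^+ 2)%:C : R[i]^o).
    elim: s => [|f s IH]; first by rewrite !big_nil.
    by rewrite !big_cons rmorphD /= -conjM_rnorm -IH.
  rewrite sumE rnorm_realC ger0_norm ?sumr_ge0 // => [|? _]; last exact: sqr_ge0.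
  rewrite (big_rem g) //= -[1]addr0 lerD ?sumr_ge0 // => [|? _]; last exact: sqr_ge0.
  by rewrite exprn_ege1 // ltW.
Qed.

(** With g from [observable_ker_ge1], |h| <= |g h| everywhere, and
    S (g h) = S g S h = 0. *)
Lemma observable_off_Spec (K : set R) h : compact K -> K `&` Spec S = set0 ->
  (forall t, h t <> 0 -> K t) -> S h = 0.
Proof.
move=> cK KS hK; have [g Sg0 g1] := observable_ker_ge1 cK KS.
apply: bounded_op_ext => x; apply: rnorm0_eq0; apply/eqP.
rewrite eq_le rnorm_ge0 andbT (@le_trans _ _ (rnorm (S (g ** h) x))) //.
  apply: observable_mono => t; rewrite -[(g ** h) t]/(g t * h t) rnormM.
  have [->|/eqP/hK/g1] := eqVneq (h t) 0; first by rewrite rnorm0 mulr0.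
  by apply: ler_peMl; exact: rnorm_ge0.
have -> : S (g ** h) x = S g (S h x) by rewrite smorphM.
by rewrite Sg0 rnorm0.
Qed.

Lemma observable_tent0 (l d : R) :
  [set t | `|t - l| <= d] `&` Spec S = set0 -> S (C0_tent l d) = 0.
Proof.
move=> dS; apply: (observable_off_Spec _ dS) => [|t /C0_tent_ball/ltW //].
rewrite (_ : [set t | _] = `[l - d, l + d]%classic); first exact: segment_compact.
by apply/seteqP; split=> t /=; rewrite in_itv /= ler_distl.
Qed.

End observable_on_H.

(** * Spectra in general C*-algebras *)

Section Spec_theory.
Context (R : realType) (A : cstarAlgType R).
Variable T : observable A.

Lemma Spec_closed : closed (Spec T).
Proof.
move=> l cl h Th0; have [ch _ _] := C0E h; apply: contrapT => hl0.
have hlp := rnorm_gt0 hl0.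
have [t [Tt /= ht]] : Spec T `&` [set t | 0 < rnorm (h t)] !=set0.
  by apply: cl; apply: (cvgr_gt _ (cvg_rnorm _ (ch l))).
by rewrite (Tt h Th0) rnorm0 ltxx in ht.
Qed.

Lemma Spec_map (B : cstarAlgType R) (s : starMorphism A B) :
  Spec (map_observable s T) `<=` Spec T.
Proof. by move=> l ls h Th0; apply: ls; rewrite /= Th0 linear0. Qed.

End Spec_theory.

(** *-morphisms into L(H) are contractive; the constant is sharpened from the
    case |a| < 1 by scaling a by 1 / (|a| + e). *)
Lemma starMorphism_rnorm_le (R : realType) (A : cstarAlgType R) (H : hilbertType R)
    (phi : starMorphism A (bounded_op H)) a x :
  rnorm (phi a x) <= rnorm a * rnorm x.
Proof.
have cl e : 0 < e -> rnorm (phi a x) <= (rnorm a + e) * rnorm x.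
  move=> e0; have K0 : 0 < rnorm a + e by rewrite ltr_wpDl ?rnorm_ge0.
  have Ki : 0 <= (rnorm a + e)^-1 by rewrite invr_ge0 ltW.
  have := @starMorphism_contracting _ _ _ phi ((rnorm a + e)^-1%:C *: a) x.
  have -> : phi ((rnorm a + e)^-1%:C *: a) x = (rnorm a + e)^-1%:C *: phi a x.
    by rewrite linearZ.
  rewrite !rnormZ //.
  by rewrite mulrC ltr_pdivrMr // mul1r ltrDl => /(_ e0); rewrite ler_pdivrMl.
apply/ler_addgt0Pr => e e0.
have K0 : 0 < 1 + rnorm x by rewrite ltr_pwDl ?rnorm_ge0.
apply: (le_trans (cl (e / (1 + rnorm x)) (divr_gt0 e0 K0))).
rewrite mulrDl lerD2l mulrAC ler_pdivrMr // ler_pM2l //.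
by rewrite lerDr.
Qed.

Lemma closed_ball_disjoint (R : realType) (Z : set R) (l : R) : closed Z ->
  ~ Z l -> exists2 d, 0 < d < 1 & [set t | `|t - l| <= d] `&` Z = set0.
Proof.
move=> cZ Zl; have : nbhs l (~` Z) by apply: open_nbhs_nbhs; split=> //; exact: closed_openC.
move=> /nbhs_ballP[e /= e0 eZ].
exists (Num.min e 1 / 2).
  have m0 : 0 < Num.min e 1 by rewrite lt_min e0 ltr01.
  have m1 : Num.min e 1 <= 1 by rewrite ge_min lexx orbT.
  by apply/andP; split; lra.
rewrite -subset0 => t [/= td Zt]; apply: (eZ t) => //=.
have m1 : Num.min e 1 <= e by rewrite ge_min lexx.
rewrite /ball /= distrC; lra.
Qed.

(** * Spectra of a family of representations *)

Lemma l2sum_ext (R : realType) (I : Type) (H : I -> hilbertType R)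
    (x y : l2sum H) : (forall i, x i = y i) -> x = y.
Proof.
case: x y => [x xP] [y yP] /= xy.
have {xy} xy : x = y by apply: functional_extensionality_dep.
by move: xP; rewrite xy => xP; rewrite (Prop_irrelevance xP yP).
Qed.

Section Spec_family.
Context (R : realType) (A : cstarAlgType R) (T : observable A).
Context (J : Type) (F : J -> representation A).
Notation SpecF := (\bigcup_(j in [set: J]) Spec (map_observable (F j) T)).

Lemma bigcup_Spec_sub : SpecF `<=` Spec T.
Proof. by move=> l [j _]; exact: Spec_map. Qed.

Lemma faithful_eq0 (a : A) : faithful F -> (forall j, F j a = 0) -> a = 0.
Proof.
move=> Finj Fa; apply: Finj; apply/funext => x.
by apply: l2sum_ext => j; rewrite /= Fa linear0.
Qed.

Lemma Spec_faithful : faithful F -> Spec T = closure SpecF.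
Proof.
move=> fF; apply/seteqP; split=> [l Tl|]; last first.
  by rewrite closureE; apply: smallest_sub; [exact: Spec_closed|exact: bigcup_Spec_sub].
apply: contrapT => /(closed_ball_disjoint (@closed_closure _ _)).
move=> [d /andP[d0 _] dF].
have /Tl/= : T (C0_tent l d) = 0.
  apply: (faithful_eq0 fF) => j.
  apply: (@observable_tent0 _ _ (map_observable (F j) T)).
  rewrite -subset0 -dF; apply: setIS => t jt; apply: subset_closure.
  by exists j.
rewrite tent_center ?ltW // => /complexI d00; by rewrite d00 ltxx in d0.
Qed.

Lemma Spec_strictly_norming : strictly_norming F -> Spec T = SpecF.
Proof.
move=> nF; apply/seteqP; split; last exact: bigcup_Spec_sub.
move=> l Tl; apply: contrapT => nl.
pose a := T (C0_tent l 1).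
have [j aj] := nF a.
have [d /andP[d0 d1] dS] : exists2 d, 0 < d < 1 &
    [set t | `|t - l| <= d] `&` Spec (map_observable (F j) T) = set0.
  by apply: closed_ball_disjoint => [|lj]; [exact: Spec_closed|apply: nl; exists j].
have Sd0 := observable_tent0 dS.
have ad : rnorm a <= 1 - d.
  rewrite /rnorm aj; apply: opnorm_le; first by rewrite subr_ge0 ltW.
  move=> x.
  have -> : F j a = map_observable (F j) T (C0_tent l 1 - C0_tent l d).
    transitivity (map_observable (F j) T (C0_tent l 1) -
                  map_observable (F j) T (C0_tent l d)); last by rewrite linearB.
    by rewrite Sd0 subr0.
  apply: observable_contracting => [|t]; first by rewrite subr_ge0 ltW.
  change (rnorm ((tent l 1 t)%:C - (tent l d t)%:C : R[i]^o) <= 1 - d).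
  rewrite -rmorphB rnorm_realC.
  rewrite ler_norml /tent !maxElt; have := normr_ge0 (t - l).
  by case: ltP => ?; case: ltP => ?; lra.
have d20 : 0 < d / 2 by rewrite divr_gt0.
have /Tl/= : T (C0_tent l (d / 2)) = 0.
  set k := C0_tent l (d / 2); have [i ki] := nF (T k).
  apply: normr0_eq0; rewrite ki.
  suff -> : F i (T k) = 0 by rewrite normr0.
  apply: bounded_op_ext => x; apply: rnorm0_eq0.
  have h1 : (1 - d / 2) * rnorm (F i (T k) x) <=
            rnorm (F i (T (C0_tent l 1 ** k)) x).
    rewrite -rnormZ ?subr_ge0; last by lra.
    have -> : (1 - d / 2)%:C *: F i (T k) x = F i (T ((1 - d / 2)%:C *: k)) x.
      by rewrite !linearZ.
    apply: (@observable_mono _ _ (map_observable (F i) T)) => t.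
    change (rnorm ((1 - d / 2)%:C * k t : R[i]^o) <=
            rnorm (C0_tent l 1 t * k t : R[i]^o)).
    rewrite !rnormM rnorm_realC !rnorm_tent ger0_norm; last by lra.
    (* Off the ball of radius d/2 both sides vanish; on it t_1 >= 1 - d/2. *)
    have [h|h] := leP (d / 2) `|t - l|; first by rewrite !(tent_off h) !mulr0.
    rewrite ler_wpM2r ?tent_ge0 // /tent le_max; apply/orP; right; lra.
  have h2 : rnorm (F i (T (C0_tent l 1 ** k)) x) <= (1 - d) * rnorm (F i (T k) x).
    rewrite !smorphM (le_trans (starMorphism_rnorm_le _ _ _)) //.
    by rewrite ler_wpM2r ?rnorm_ge0.
  apply/eqP; rewrite eq_le rnorm_ge0 andbT -(pmulr_rle0 _ d20); lra.
rewrite tent_center ?ltW // => /complexI d00; by rewrite d00 ltxx in d20.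
Qed.

End Spec_family.

Theorem theorem5p4 (R : realType) (A : cstarAlgType R) (hA : unital A)
    (T : observable A) (J : Type) (F : J -> representation A) :
  (strictly_norming F ->
     Spec T = \bigcup_(j in [set: J]) Spec (map_observable (F j) T)) /\
  (faithful F ->
     Spec T = closure (\bigcup_(j in [set: J]) Spec (map_observable (F j) T))).
Proof. by split; [exact: Spec_strictly_norming|exact: Spec_faithful]. Qed.
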